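(* Let $a\in\mathbb{R}$. Then $a\in\mathcal{O}$ (i.e. $a$ is origami constructible) if and only if there are an integer $n\geq 0$ and subfields $F_0,F_1,\dots,F_n$ of $\mathbb{R}$ such that $\mathbb{Q}=F_0\subseteq F_1\subseteq\dots\subseteq F_n$, $[F_i:F_{i-1}]\in\{2,3\}$ for every $1\leq i\leq n$, and $a\in F_n$. In particular, if $a\in\mathcal{O}$, then $[\mathbb{Q}(a):\mathbb{Q}]=2^r3^s$ for some integers $r,s\geq 0$.
   Context: Origami constructions in the Euclidean plane $\mathbb{R}^2$. One starts from two fixed points, $(0,0)$ and $(1,0)$ (the endpoints of the unit segment), which are regarded as constructed. A point or line is constructed (constructible) if it is obtained after finitely many applications of the following steps: (i) draw the line through two distinct constructed points; (ii) take the intersection point of two distinct nonparallel constructed lines; (iii) draw the perpendicular bisector of the segment joining two distinct constructed points; (iv) draw a line bisecting an angle formed by two intersecting constructed lines; (v) given a constructed line $l$ and constructed points $P\notin l$ and $Q$, draw a line through $Q$ such that reflection in it sends $P$ to a point of $l$, whenever such a line exists (equivalently, a tangent through $Q$ to the parabola with focus $P$ and directrix $l$); (vi) given constructed lines $l,m$ and constructed points $P\notin l$, $Q\notin m$ with $(P,l)\neq(Q,m)$, draw a line such that reflection in it sends $P$ to a point of $l$ and $Q$ to a point of $m$, whenever such a line exists (equivalently, a common tangent to the parabola with focus $P$ and directrix $l$ and the parabola with focus $Q$ and directrix $m$). A real $x\geq 0$ is origami constructible if $x$ is the length of a (possibly degenerate) segment whose endpoints are constructible points; a real $x<0$ is origami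 constructible if $-x$ is. $\mathcal{O}=\{x\in\mathbb{R} : x \text{ is origami constructible}\}$. *)

(* Defs.v *)
From mathcomp Require Import all_boot all_order all_algebra.
From mathcomp Require Import boolp classical_sets reals trigo.

Set Implicit Arguments.
Unset Strict Implicit.
Unset Printing Implicit Defensive.

Import Order.TTheory GRing.Theory Num.Theory.

Local Open Scope classical_set_scope.
Local Open Scope ring_scope.

(* The canonical norm on a product type is the sup norm, so the Euclidean
   distance is spelled out. *)
Definition dist (R : realType) (P Q : R * R) : R :=
  Num.sqrt ((P.1 - Q.1) ^+ 2 + (P.2 - Q.2) ^+ 2).

(* Lines are subsets of the plane, so that equality of lines is equality of
   point sets and does not depend on the choice of an equation. *)
Definition is_line (R : realType) (l : set (R * R)) : Prop :=
  exists a b c : R, (a, b) <> (0, 0) /\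
    l = [set X : R * R | a * X.1 + b * X.2 = c].

(* A line only if P <> Q. *)
Definition line_through (R : realType) (P Q : R * R) : set (R * R) :=
  [set X : R * R | exists t : R,
     X = (P.1 + t * (Q.1 - P.1), P.2 + t * (Q.2 - P.2))].

Definition parallel (R : realType) (l m : set (R * R)) : Prop :=
  l = m \/ l `&` m = set0.

(* A line only if P <> Q. *)
Definition perp_bisector (R : realType) (P Q : R * R) : set (R * R) :=
  [set X : R * R | dist X P = dist X Q].

(* Unoriented angle at O, in [0, pi]; meaningful only if A <> O and B <> O. *)
Definition angle (R : realType) (A O B : R * R) : R :=
  acos (((A.1 - O.1) * (B.1 - O.1) + (A.2 - O.2) * (B.2 - O.2))
        / (dist A O * dist B O)).

(* The rays OA and OB range over all choices of rays carried by l and m, so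
   both bisectors of the pair of lines are covered.  Since OA and OB are not
   collinear, the angle condition forces the line OX to be the bisector of the
   angle AOB (X itself may lie on the ray opposite to the bisecting one). *)
Definition angle_bisector (R : realType) (l m b : set (R * R)) : Prop :=
  exists O A B X : R * R,
    [/\ l O, m O, l A & m B] /\ [/\ A <> O, B <> O & X <> O] /\
    angle A O X = angle X O B /\ b = line_through O X.

(* The reflection in the line t sends P to P'. *)
Definition reflects (R : realType) (t : set (R * R)) (P P' : R * R) : Prop :=
  (t P /\ P' = P) \/ (P <> P' /\ t = perp_bisector P P').

Inductive constructed_point (R : realType) : R * R -> Prop :=
| constructed_origin : constructed_point (0, 0)
| constructed_unit : constructed_point (1, 0)
| constructed_intersection (l m : set (R * R)) (P : R * R) :
    constructed_line l -> constructed_line m ->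
    l <> m -> ~ parallel l m -> l P -> m P ->
    constructed_point P
with constructed_line (R : realType) : set (R * R) -> Prop :=
| constructed_line_through (P Q : R * R) :
    constructed_point P -> constructed_point Q -> P <> Q ->
    constructed_line (line_through P Q)
| constructed_perp_bisector (P Q : R * R) :
    constructed_point P -> constructed_point Q -> P <> Q ->
    constructed_line (perp_bisector P Q)
| constructed_angle_bisector (l m b : set (R * R)) :
    constructed_line l -> constructed_line m ->
    l <> m -> ~ parallel l m -> angle_bisector l m b ->
    constructed_line b
| constructed_fold_tangent (l t : set (R * R)) (P Q P' : R * R) :
    constructed_line l -> constructed_point P -> constructed_point Q ->
    ~ l P ->
    is_line t -> t Q -> reflects t P P' -> l P' ->
    constructed_line t
| constructed_fold_common_tangent (l m t : set (R * R)) (P Q P' Q' : R * R) :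
    constructed_line l -> constructed_line m ->
    constructed_point P -> constructed_point Q ->
    ~ l P -> ~ m Q -> (P, l) <> (Q, m) ->
    is_line t -> reflects t P P' -> l P' -> reflects t Q Q' -> m Q' ->
    constructed_line t.

Definition constructible_length (R : realType) (x : R) : Prop :=
  exists P Q : R * R,
    [/\ constructed_point P, constructed_point Q & x = dist P Q].

Definition origami (R : realType) : set R :=
  [set x : R | (0 <= x /\ constructible_length x) \/
               (x < 0 /\ constructible_length (- x))].
Arguments origami : clear implicits.

Definition subfield (R : realType) (K : set R) : Prop :=
  GRing.divring_closed (mem K).

(* For subfields K and L: K is contained in L and [L : K] = d, that is, L has a
   K-basis with d elements. *)
Definition ext_degree (R : realType) (K L : set R) (d : nat) : Prop :=
  K `<=` L /\
  exists e : 'I_d -> R,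
    [/\ forall i, L (e i),
        forall c : 'I_d -> R, (forall i, K (c i)) ->
          \sum_(i < d) c i * e i = 0 -> forall i, c i = 0 &
        forall x, L x -> exists c : 'I_d -> R,
          (forall i, K (c i)) /\ x = \sum_(i < d) c i * e i].

(* The subfield Q(a) of R; every subfield contains the rationals. *)
Definition rational_adjoin (R : realType) (a : R) : set R :=
  [set x : R | forall K : set R, subfield K -> K a -> K x].

(* Main.v *)
Require Import Defs.
From mathcomp Require Import all_boot all_order all_algebra.
From mathcomp Require Import boolp classical_sets reals trigo.
From mathcomp Require Import ring lra.

(** Call a subfield K of the reals cubic closed when it contains every real
root of every nonzero polynomial of degree at most 3 over K.  The origami
numbers and the union of all towers of extensions of degree 2 or 3 over the
rationals both turn out to be the least cubic closed subfield.

Each fold involves only an equation of degree at most 3.  A line is pinned down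
by a condition that is linear (lines through points, perpendicular bisectors),
quadratic (angle bisectors, tangents to a parabola through a point) or cubic
(common tangents of two parabolas, which as dual conics meet in at most three
points besides the line at infinity).  So everything constructible has
coordinates in any cubic closed K ([constructed_over],
[origami_sub_cubic_closed]); the delicate point is that the cubic of [line_over_fold_common_tangent] does not
vanish identically, which holds because the two parabolas differ.

Conversely the abscissas of constructible points form a cubic closed field
([abscissa_cubic_closed]).  Parallels are drawn by the straightedge
construction of Steiner, which turns the usual similar triangles into field
operations, and Beloch's fold solves cubic equations: the tangents to the
parabola x^2 = 4y have slope s and equation y = sx - s^2, and requiring that
the reflection of a suitable second focus lie on a vertical line is an
arbitrary monic cubic equation in s with nonzero constant term.

On the algebraic side, the elements of towers form a cubic closed field
([in_tower_cubic_closed]) because a root of a cubic generates an extension of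
degree 1, 2 or 3, and because two towers embed in a third one: adjoin to the
first, one after the other, the basis elements of each step of the second.
They lie in every cubic closed field ([tower_sub_cubic_closed]) because an
element of an extension of degree at most 3 is a root of a cubic.  The degree
statement is the tower law together with the divisibility of degrees
([ext_degree_between]). *)

Set Implicit Arguments.
Unset Strict Implicit.
Unset Printing Implicit Defensive.

Import Order.TTheory GRing.Theory Num.Theory.

Local Open Scope classical_set_scope.
Local Open Scope ring_scope.

(** * Subfields of the reals *)

Section Subfield.
Variables (R : realType) (K : set R).
Hypothesis hK : subfield K.

Lemma subfield1 : K 1.
Proof. by have [] := hK; rewrite in_setE. Qed.

Lemma subfieldB x y : K x -> K y -> K (x - y).
Proof. by have [_ + _] := hK => /(_ x y); rewrite !in_setE. Qed.

Lemma subfield_div x y : K x -> K y -> K (x / y).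
Proof. by have [_ _] := hK => /(_ x y); rewrite !in_setE. Qed.

Lemma subfield0 : K 0.
Proof. by rewrite -(subrr 1); apply: subfieldB; apply: subfield1. Qed.

Lemma subfieldN x : K x -> K (- x).
Proof. by rewrite -sub0r => ?; apply: subfieldB => //; apply: subfield0. Qed.

Lemma subfieldD x y : K x -> K y -> K (x + y).
Proof.
by move=> ? ?; rewrite -[y]opprK; apply: subfieldB => //; apply: subfieldN.
Qed.

Lemma subfieldV x : K x -> K x^-1.
Proof. by rewrite -div1r => ?; apply: subfield_div => //; apply: subfield1. Qed.

Lemma subfieldM x y : K x -> K y -> K (x * y).
Proof.
by move=> ? ?; rewrite -[y]invrK; apply: subfield_div => //; apply: subfieldV.
Qed.

Lemma subfieldX x n : K x -> K (x ^+ n).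
Proof.
move=> Kx; elim: n => [|n IHn]; first exact: subfield1.
by rewrite exprS; apply: subfieldM.
Qed.

Lemma subfield_sum n (F : 'I_n -> R) :
  (forall i, K (F i)) -> K (\sum_(i < n) F i).
Proof.
move=> KF; apply: (big_ind K) => //; [exact: subfield0|exact: subfieldD].
Qed.

Lemma subfield_nat n : K n%:R.
Proof.
elim: n => [|n IHn]; first exact: subfield0.
by rewrite -natr1; apply: subfieldD => //; apply: subfield1.
Qed.

Lemma subfield_int (z : int) : K z%:~R.
Proof.
case: z => n; rewrite ?NegzE ?mulrNz -pmulrn; last apply: subfieldN.
all: exact: subfield_nat.
Qed.

Lemma rational_subset : @rational R `<=` K.
Proof.
move=> x /rationalP[z [n ->]].
by apply: subfield_div; [exact: subfield_int | exact: subfield_nat].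
Qed.

End Subfield.

(** Decides membership of a rational expression, up to leaving the atoms that
are not hypotheses. *)
Ltac in_subfield :=
  try match goal with hK : subfield ?K |- ?K _ =>
    repeat first
      [ assumption
      | exact (subfield1 hK)
      | exact (subfield0 hK)
      | exact (subfield_nat hK _)
      | refine (subfieldN hK _)
      | refine (subfieldD hK _ _)
      | refine (subfield_div hK _ _)
      | refine (subfieldM hK _ _)
      | refine (subfieldV hK _)
      | refine (subfieldX hK _ _) ]
  end.

Lemma subfieldP (R : realType) (K : set R) :
  K 1 -> (forall x y, K x -> K y -> K (x - y)) ->
  (forall x y, K x -> K y -> K (x / y)) -> subfield K.
Proof.
move=> K1 KB Kd; split; first by rewrite in_setE.
- by move=> x y; rewrite !in_setE; apply: KB.
- by move=> x y; rewrite !in_setE; apply: Kd.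
Qed.

Lemma subfield_rational (R : realType) : subfield (@rational R).
Proof.
apply: subfieldP => [|_ _ [p _ <-] [q _ <-]|_ _ [p _ <-] [q _ <-]].
- by exists 1 => //; rewrite rmorph1.
- by exists (p - q) => //; rewrite rmorphB.
- by exists (p / q) => //; rewrite fmorph_div.
Qed.

(** * Linear algebra over a subfield *)

Section LinearAlgebra.
Variable R : realType.
Implicit Types (K L M V : set R).

Definition spans K n (e : 'I_n -> R) (x : R) : Prop :=
  exists c : 'I_n -> R, (forall i, K (c i)) /\ x = \sum_(i < n) c i * e i.

Definition indep K n (e : 'I_n -> R) : Prop :=
  forall c : 'I_n -> R, (forall i, K (c i)) ->
    \sum_(i < n) c i * e i = 0 -> forall i, c i = 0.

(** A homogeneous linear system over K with more unknowns than equations has a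
nontrivial solution in K: eliminate one unknown and one equation at a time, by
Gaussian pivoting, which stays inside K. *)
Lemma exists_left_kernel K n m (a : 'I_m -> 'I_n -> R) :
  subfield K -> (n < m)%N -> (forall i j, K (a i j)) ->
  exists c : 'I_m -> R, [/\ forall i, K (c i), exists i, c i != 0
    & forall j, \sum_(i < m) c i * a i j = 0].
Proof.
move=> hK; elim: n m a => [|n IHn] [|m] a // ltnm Ka.
  exists (fun=> 1); split=> [i||[]//]; first by in_subfield.
  by exists ord0; rewrite oner_neq0.
have [[i0 ai0]|a0] := pselect (exists i, a i ord0 != 0); last first.
  have [|c [Kc c0 rc]] := IHn m.+1 (fun i j => a i (lift ord0 j)) (ltnW ltnm).
    by move=> *; apply: Ka.
  exists c; split=> // j; case: (unliftP ord0 j) => [j' ->|->]; first exact: rc.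
  rewrite big1 // => i _; apply/eqP; rewrite mulf_eq0; apply/orP; right.
  by apply/negP => /negP ai; apply: a0; exists i.
pose b i j := a (lift i0 i) (lift ord0 j) -
  a (lift i0 i) ord0 / a i0 ord0 * a i0 (lift ord0 j).
have Kb i j : K (b i j) by rewrite /b; in_subfield; apply: Ka.
have [c [Kc [i1 ci1] rc]] := IHn m b ltnm Kb.
(* The coefficient of the pivot row that kills the eliminated column. *)
pose t := - \sum_(i < m) c i * (a (lift i0 i) ord0 / a i0 ord0).
exists (fun i => if unlift i0 i is Some i' then c i' else t); split.
- move=> i; case: unliftP => [i' _|_]; first exact: Kc.
  apply: subfieldN => //; apply: subfield_sum => // i'.
  by in_subfield; apply: Ka || apply: Kc.
- by exists (lift i0 i1); rewrite liftK.
- move=> j; rewrite (bigD1_ord i0) //= unlift_none.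
  under eq_bigr do rewrite liftK.
  case: (unliftP ord0 j) => [j' ->|->].
    rewrite -[RHS](rc j') /b /t mulNr mulr_suml addrC -sumrB.
    by apply: eq_bigr => i _; ring.
  rewrite /t mulNr mulr_suml addrC -sumrB big1 // => i _.
  by rewrite mulrA divfK // subrr.
Qed.

(** Steinitz: write the f i in terms of the e j; more f's than e's would give a
K-relation by [exists_left_kernel]. *)
Lemma indep_leq K n m (e : 'I_n -> R) (f : 'I_m -> R) :
  subfield K -> indep K f -> (forall i, spans K e (f i)) -> (m <= n)%N.
Proof.
move=> hK If /choice[a Pa]; rewrite leqNgt; apply/negP => ltnm.
have [|c [Kc [i ci] rc]] := @exists_left_kernel K n m a hK ltnm.
  by move=> i j; have [] := Pa i.
apply/negP: ci; rewrite negbK; apply/eqP; apply: If => //.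
under eq_bigr => k _ do [have [_ ->] := Pa k; rewrite mulr_sumr].
rewrite exchange_big big1 // => j _ /=.
by under eq_bigr do rewrite mulrA; rewrite -mulr_suml rc mul0r.
Qed.

Definition family_cons n (x : R) (f : 'I_n -> R) : 'I_n.+1 -> R :=
  fun i => if unlift ord0 i is Some j then f j else x.

Lemma indep_cons K n (x : R) (f : 'I_n -> R) :
  subfield K -> indep K f -> ~ spans K f x -> indep K (family_cons x f).
Proof.
move=> hK If nfx c Kc; rewrite (bigD1_ord ord0) //= /family_cons unlift_none.
under eq_bigr do rewrite liftK.
have [c0|c0] := eqVneq (c ord0) 0.
  rewrite c0 mul0r add0r => /If cf i.
  by case: (unliftP ord0 i) => [j ->|->] //; apply: cf.
move=> /eqP; rewrite addr_eq0 => /eqP cx; case: nfx.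
exists (fun i => - (c (lift ord0 i) / c ord0)).
split=> [i|]; first by in_subfield; apply: Kc.
apply: (mulfI c0); rewrite cx mulr_sumr -sumrN; apply: eq_bigr => i _.
by field.
Qed.

(** A K-independent family of elements of V of maximal length spans V, by
[indep_cons]; lengths are bounded by [indep_leq]. *)
Lemma exists_basis K V n (e : 'I_n -> R) :
  subfield K -> (forall x, V x -> spans K e x) ->
  exists d (f : 'I_d -> R), [/\ forall i, V (f i), indep K f
    & forall x, V x -> spans K f x].
Proof.
move=> hK Ve.
pose P m := `[< exists f : 'I_m -> R, (forall i, V (f i)) /\ indep K f >].
have exP : exists m, P m.
  by exists 0%N; apply/asboolP; exists (fun=> 0); split=> [[]|c _ _ []].
have ubP m : P m -> (m <= n)%N.
  move=> /asboolP[f [Vf If]]; apply: indep_leq hK If _ => i.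
  exact: Ve.
case: (ex_maxnP exP ubP) => d /asboolP[f [Vf If]] maxd.
exists d, f; split=> // x Vx; apply: contrapT => nfx.
suff /maxd : P d.+1 by rewrite ltnn.
apply/asboolP; exists (family_cons x f); split; last exact: indep_cons.
by move=> i; rewrite /family_cons; case: unliftP => [j _|_].
Qed.

Lemma spans_sub K L n (e : 'I_n -> R) x : K `<=` L -> spans K e x -> spans L e
  x.
Proof. by move=> KL [c [Kc ->]]; exists c; split=> // i; apply: KL. Qed.

Lemma ext_degree_unique K L m n :
  subfield K -> ext_degree K L m -> ext_degree K L n -> m = n.
Proof.
move=> hK [_ [e [Le Ie se]]] [_ [f [Lf If sf]]]; apply/eqP; rewrite eqn_leq.
apply/andP; split.
  by apply: indep_leq hK Ie _ => i; apply: sf.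
by apply: indep_leq hK If _ => i; apply: se.
Qed.

(** The products of the elements of a K-basis of L by those of an L-basis of M
form a K-basis of M. *)
Lemma ext_degree_mul K L M m n :
  subfield K -> subfield L -> subfield M ->
  ext_degree K L m -> ext_degree L M n -> ext_degree K M (m * n).
Proof.
move=> hK hL hM [KL [e [Le Ie se]]] [LM [f [Mf If sf]]].
split; first exact: subset_trans KL LM.
have cardE : #|{: 'I_m * 'I_n}| = (m * n)%N by rewrite card_prod !card_ord.
rewrite -cardE; pose g (p : 'I_m * 'I_n) := e p.1 * f p.2.
have gE (c : 'I_m * 'I_n -> R) : \sum_(k < #|{: 'I_m * 'I_n}|)
    c (enum_val k) * g (enum_val k) =
    \sum_(j < n) (\sum_(i < m) c (i, j) * e i) * f j.
  transitivity (\sum_(p : 'I_m * 'I_n) c p * g p).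
    rewrite (reindex (@enum_val _ [in {: 'I_m * 'I_n}])) //=.
    exact: onW_bij (@enum_val_bij _).
  rewrite (eq_bigr (fun p => c (p.1, p.2) * g (p.1, p.2))); last by case.
  rewrite -(pair_bigA _ (fun i j => c (i, j) * g (i, j))) exchange_big /=.
  by apply: eq_bigr => j _; rewrite mulr_suml; apply: eq_bigr => i _;
    rewrite mulrA.
exists (fun k => g (enum_val k)); split.
- by move=> k; apply: subfieldM => //; apply: LM.
- move=> c Kc c0 k; rewrite -(enum_valK k).
  pose c' p := c (enum_rank p).
  have {c0} : \sum_(j < n) (\sum_(i < m) c' (i, j) * e i) * f j = 0.
    by rewrite -gE -[RHS]c0; apply: eq_bigr => i _; rewrite /c' enum_valK.
  move=> /If cf; have {cf} cf j : \sum_(i < m) c' (i, j) * e i = 0.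
    apply: cf => {}j; apply: subfield_sum => // i.
    by apply: subfieldM => //; apply: KL; apply: Kc.
  case: (enum_val k) => i j; apply: (Ie (fun i => c' (i, j))) => //.
  by move=> ?; apply: Kc.
- move=> x /sf[b [Lb ->]].
  have /choice[c Pc] : forall j, spans K e (b j) by move=> j; apply: se.
  exists (fun k => c (enum_val k).2 (enum_val k).1); split.
    by move=> k; have [] := Pc (enum_val k).2.
  rewrite (gE (fun p => c p.2 p.1)); apply: eq_bigr => j _.
  by have [_ ->] := Pc j.
Qed.

(** An intermediate field of a finite extension M / K has finite degree over K,
and M has finite degree over it, so the tower law gives the divisibility. *)
Lemma ext_degree_between K L M n :
  subfield K -> subfield L -> subfield M -> K `<=` L -> L `<=` M ->
  ext_degree K M n ->
  exists d, ext_degree K L d /\ (d %| n)%N.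
Proof.
move=> hK hL hM KL LM dKM; have [_ [e [Me Ie se]]] := dKM.
have [|d [f [Lf If sf]]] := @exists_basis K L n e hK.
  by move=> x Lx; apply: se; apply: LM.
have [|d' [f' [Lf' If' sf']]] := @exists_basis L M n e hL.
  by move=> x Mx; apply: spans_sub KL _; apply: se.
have dKL : ext_degree K L d by split=> //; exists f.
have dLM : ext_degree L M d' by split=> //; exists f'.
exists d; split=> //.
by rewrite (ext_degree_unique hK dKM (ext_degree_mul hK hL hM dKL dLM))
  dvdn_mulr.
Qed.

End LinearAlgebra.

(** * Roots of cubics *)

Section Cubic.
Variable R : realType.
Implicit Types (K L M : set R).

(** The leading coefficients may vanish, so that roots of linear and quadratic
polynomials are covered. *)
Definition cubic_over K (x : R) : Prop :=
  exists c0 c1 c2 c3 : R, [/\ [/\ K c0, K c1, K c2 & K c3],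
    ~ [/\ c0 = 0, c1 = 0, c2 = 0 & c3 = 0] &
    c0 + c1 * x + c2 * x ^+ 2 + c3 * x ^+ 3 = 0].

Definition cubic_closed K : Prop :=
  subfield K /\ forall x, cubic_over K x -> K x.

Lemma cubic_over_sub K L x : K `<=` L -> cubic_over K x -> cubic_over L x.
Proof.
move=> KL [c0 [c1 [c2 [c3 [[k0 k1 k2 k3] nz e]]]]].
by exists c0, c1, c2, c3; split=> //; split; apply: KL.
Qed.

(** Multiplying a nonzero polynomial of smaller degree by a power of the variable
makes its degree exactly 3. *)
Lemma cubic_over_monic K x : subfield K -> cubic_over K x ->
  exists p q r, [/\ K p, K q, K r & x ^+ 3 = p + q * x + r * x ^+ 2].
Proof.
move=> hK [c0 [c1 [c2 [c3 [[k0 k1 k2 k3] nz e]]]]].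
have [z3|z3] := eqVneq c3 0; last first.
  exists (- (c0 / c3)), (- (c1 / c3)), (- (c2 / c3)).
  split; [by in_subfield..|]; apply: (mulfI z3).
  by apply/eqP; rewrite -subr_eq0 -[X in _ == X]e; apply/eqP; field.
have [z2|z2] := eqVneq c2 0; last first.
  exists 0, (- (c0 / c2)), (- (c1 / c2)).
  split; [by in_subfield..|]; apply: (mulfI z2).
  apply/eqP; rewrite -subr_eq0 -[X in _ == X](mulr0 x) -[X in _ == _ * X]e z3.
  by apply/eqP; field.
have [z1|z1] := eqVneq c1 0; last first.
  exists 0, 0, (- (c0 / c1)).
  split; [by in_subfield..|]; apply: (mulfI z1).
  apply/eqP; rewrite -subr_eq0 -[X in _ == X](mulr0 (x ^+ 2)).
  by rewrite -[X in _ == _ * X]e z3 z2; apply/eqP; field.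
case: nz; split=> //.
by move: e; rewrite z1 z2 z3 !mul0r !addr0.
Qed.

(** Conversely, dividing by a power of a nonzero root makes the constant term
nonzero. *)
Lemma cubic_over_const K x : cubic_over K x -> x != 0 ->
  exists c0 c1 c2 c3 : R, [/\ [/\ K c0, K c1, K c2 & K c3], c0 != 0 &
    c0 + c1 * x + c2 * x ^+ 2 + c3 * x ^+ 3 = 0].
Proof.
move=> [c0 [c1 [c2 [c3 [[k0 k1 k2 k3] nz e]]]]] x0.
have [z0|z0] := eqVneq c0 0; last by exists c0, c1, c2, c3.
have {}e : c1 + c2 * x + c3 * x ^+ 2 + c0 * x ^+ 3 = 0.
  by apply: (mulfI x0); rewrite mulr0 -[RHS]e z0; ring.
have [z1|z1] := eqVneq c1 0; last by exists c1, c2, c3, c0.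
have {}e : c2 + c3 * x + c0 * x ^+ 2 + c1 * x ^+ 3 = 0.
  by apply: (mulfI x0); rewrite mulr0 -[RHS]e z0 z1; ring.
have [z2|z2] := eqVneq c2 0; last by exists c2, c3, c0, c1.
have {}e : c3 = 0.
  by apply: (mulfI x0); rewrite mulr0 -[RHS]e z0 z1 z2; ring.
by case: nz.
Qed.

(** The four powers 1, x, x^2, x^3 lie in a space of dimension at most 3, hence
are K-dependent. *)
Lemma spans_cubic_over K n (e : 'I_n -> R) x :
  subfield K -> (n <= 3)%N -> (forall i : 'I_4, spans K e (x ^+ i)) ->
  cubic_over K x.
Proof.
move=> hK le3 /choice[a Pa].
have [||c [Kc [i ci] rc]] := @exists_left_kernel R K n 4 a hK.
- by rewrite ltnS.
- by move=> i j; have [] := Pa i.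
have ce : \sum_(i < 4) c i * x ^+ i = 0.
  under eq_bigr => k _ do [have [_ ->] := Pa k; rewrite mulr_sumr].
  rewrite exchange_big big1 // => j _ /=.
  by under eq_bigr do rewrite mulrA; rewrite -mulr_suml rc mul0r.
exists (c (inord 0)), (c (inord 1)), (c (inord 2)), (c (inord 3)); split=> //.
  move=> [z0 z1 z2 z3]; move: ci; rewrite -[i]inord_val.
  by case: i => [[|[|[|[|]]]]] //= _; rewrite ?z0 ?z1 ?z2 ?z3 eqxx.
rewrite -[RHS]ce !big_ord_recr big_ord0 /= add0r expr0 mulr1 expr1.
by congr (c _ + c _ * _ + c _ * _ + c _ * _); apply/val_inj; rewrite /= inordK.
Qed.

Lemma ext_degree_cubic_over K L d x : subfield K -> subfield L ->
  ext_degree K L d -> (d <= 3)%N -> L x -> cubic_over K x.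
Proof.
move=> hK hL [_ [e [_ _ se]]] led Lx; apply: (spans_cubic_over hK led) => i.
by apply: se; in_subfield.
Qed.

(** The K-span L of 1, x, x^2 is a ring because x^3 lies in it.  It is a field:
a nonzero y in L is a root of a cubic over K with nonzero constant term, which
expresses the inverse of y as a combination of 1, y, y^2. *)
Lemma exists_cubic_extension K x : subfield K -> cubic_over K x ->
  exists L d, [/\ subfield L, L x, (0 < d <= 3)%N & ext_degree K L d].
Proof.
move=> hK /(cubic_over_monic hK)[p [q [r [Kp Kq Kr e3]]]].
pose L y := exists u v w, [/\ K u, K v, K w & y = u + v * x + w * x ^+ 2].
pose b (i : 'I_3) := x ^+ i.
have Lb y : L y -> spans K b y.
  move=> [u [v [w [Ku Kv Kw ->]]]].
  exists (fun i : 'I_3 => [:: u; v; w]`_i); split.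
    by case=> [[|[|[|]]]].
  by rewrite !big_ord_recr big_ord0 /= /b add0r expr0 mulr1 expr1.
have KL : K `<=` L by move=> u Ku; exists u, 0, 0; split; in_subfield; ring.
have LB y z : L y -> L z -> L (y - z).
  move=> [u [v [w [Ku Kv Kw ->]]]] [u' [v' [w' [Ku' Kv' Kw' ->]]]].
  by exists (u - u'), (v - v'), (w - w'); split; in_subfield; ring.
have LM y z : L y -> L z -> L (y * z).
  move=> [u [v [w [Ku Kv Kw ->]]]] [u' [v' [w' [Ku' Kv' Kw' ->]]]].
  (* The product modulo x^3 - p - q x - r x^2; the quotient is s + t x. *)
  pose s := v * w' + w * v' + w * w' * r; pose t := w * w'.
  exists (u * u' + s * p), (u * v' + v * u' + s * q + t * p).
  exists (u * w' + v * v' + w * u' + s * r + t * q).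
  split; rewrite /s /t; in_subfield.
  transitivity ((u + v * x + w * x ^+ 2) * (u' + v' * x + w' * x ^+ 2) +
    (s + t * x) * (p + q * x + r * x ^+ 2 - x ^+ 3)).
    by rewrite -e3 subrr mulr0 addr0.
  by rewrite /s /t; ring.
have L1 : L 1 by apply: KL; in_subfield.
have LX y n : L y -> L (y ^+ n).
  by move=> Ly; elim: n => // n IHn; rewrite exprS; apply: LM.
have LV y : L y -> L y^-1.
  move=> Ly; have [->|y0] := eqVneq y 0; first by rewrite invr0; apply: KL;
    in_subfield.
  have : cubic_over K y by apply: (spans_cubic_over (e := b)) => // i;
    apply/Lb/LX.
  move=> /cubic_over_const/(_ y0)[c0 [c1 [c2 [c3 [[k0 k1 k2 k3] c00 e]]]]].
  have -> : y^-1 = - (c1 / c0) * y ^+ 0 - c2 / c0 * y ^+ 1 - c3 / c0 * y ^+ 2.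
    apply: (mulfI c00); apply: (mulfI y0); apply/eqP.
    rewrite -subr_eq0 -[X in _ == X]e; apply/eqP; field.
    by rewrite y0 c00.
  have LZ c n : K c -> L (c * y ^+ n) by move=> /KL Lc; apply: LM => //;
    apply: LX.
  by apply: (LB); [apply: (LB)|]; apply: (LZ); in_subfield.
have hL : subfield L by apply: subfieldP => // y z Ly Lz; apply: LM => //;
  apply: LV.
have [d [f [Lf If sf]]] := exists_basis hK Lb.
exists L, d; split=> //.
- by exists 0, 1, 0; split; in_subfield; ring.
- apply/andP; split; last by apply: indep_leq hK If _ => i; apply/Lb/Lf.
  case: d f Lf If sf => // f _ _ /(_ 1 L1)[c [_]]; rewrite big_ord0 => /eqP.
  by rewrite oner_eq0.
- by split=> //; exists f.
Qed.
End Cubic.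

(** * Towers of quadratic and cubic extensions *)

Section Towers.
Variable R : realType.
Implicit Types (K L M : set R).

Inductive tower : set R -> Prop :=
| tower_rational : tower (@rational R)
| tower_extend K L : tower K -> subfield L ->
    ext_degree K L 2 \/ ext_degree K L 3 -> tower L.

Lemma tower_subfield K : tower K -> subfield K.
Proof. by case=> // {K}; apply: subfield_rational. Qed.

(** The extension of [exists_cubic_extension] has degree 1, 2 or 3; in degree 1
the root is already in K and no step is added. *)
Lemma tower_adjoin K x : tower K -> cubic_over K x ->
  exists L, [/\ tower L, K `<=` L & L x].
Proof.
move=> tK cx; have hK := tower_subfield tK.
have [L [d [hL Lx /andP[d0 d3] dKL]]] := exists_cubic_extension hK cx.
have [KL [e [Le Ie se]]] := dKL.
case: d => [|[|[|[|]]]] // in d0 d3 e Le Ie se dKL *; last first.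
- by exists L; split=> //; apply: tower_extend tK hL _; right.
- by exists L; split=> //; apply: tower_extend tK hL _; left.
exists K; split=> //.
have [c [Kc]] := se 1 (subfield1 hL); have [b [Kb]] := se x Lx.
rewrite !big_ord_recr !big_ord0 /= !add0r => -> e1.
have c0 : c ord_max != 0.
  by apply/eqP => c0; move: e1; rewrite c0 mul0r => /eqP; rewrite oner_eq0.
have -> : e ord_max = (c ord_max)^-1 by rewrite -[LHS](mulKf c0) -e1 mulr1.
by in_subfield; [exact: Kb | exact: Kc].
Qed.

Lemma tower_adjoin_family K n (e : 'I_n -> R) : tower K ->
  (forall i, cubic_over K (e i)) ->
  exists L, [/\ tower L, K `<=` L & forall i, L (e i)].
Proof.
move=> tK; elim: n e => [|n IHn] e ce; first by exists K; split=> // -[].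
have [|L [tL KL Le]] := IHn (fun i => e (lift ord0 i)); first by move=> i;
  apply: ce.
have [|M [tM LM Me]] := @tower_adjoin L (e ord0) tL.
  by apply: cubic_over_sub KL _.
exists M; split=> //; first exact: subset_trans KL LM.
by move=> i; case: (unliftP ord0 i) => [j ->|->] //; apply: LM; apply: Le.
Qed.

(** By induction on the tower of L: the basis elements of each of its steps are
roots of cubics over the previous field, so they can be adjoined one by one to
a tower that contains K and that previous field. *)
Lemma tower_directed K L : tower K -> tower L ->
  exists M, [/\ tower M, K `<=` M & L `<=` M].
Proof.
move=> tK; elim=> [|{}L L' tL [M [tM KM LM]] hL' dLL'].
  by exists K; split=> //; apply: rational_subset; apply: tower_subfield.
have hL := tower_subfield tL.
have [d [led [LL' [e [Le Ie se]]]]] : exists d, (d <= 3)%N /\ ext_degree L L' d.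
  by case: dLL' => dLL'; [exists 2%N | exists 3%N].
have dLL : ext_degree L L' d by split=> //; exists e.
have [|M' [tM' MM' Me]] := @tower_adjoin_family M d e tM.
  move=> i; apply: cubic_over_sub LM _.
  exact: (ext_degree_cubic_over hL hL' dLL led).
exists M'; split=> //; first exact: subset_trans KM MM'.
have hM' := tower_subfield tM'.
move=> x /se[c [Lc ->]]; apply: subfield_sum => // i.
by apply: subfieldM => //; apply/MM'/LM.
Qed.

Definition in_tower (x : R) : Prop := exists K, tower K /\ K x.

Lemma in_tower_cubic_closed : cubic_closed in_tower.
Proof.
have dir2 x y : in_tower x -> in_tower y -> exists K, [/\ tower K, K x & K y].
  move=> [K [tK Kx]] [L [tL Ly]]; have [M [tM KM LM]] := tower_directed tK tL.
  by exists M; split=> //; [apply: KM | apply: LM].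
split.
  apply: subfieldP => [|x y /dir2 xy /xy[K [tK Kx Ky]]|x y /dir2 xy /xy[K [tK
    Kx Ky]]].
  - exists (@rational R); split; first exact: tower_rational.
    by apply: subfield1; apply: subfield_rational.
  - by exists K; split=> //; apply: subfieldB => //; apply: tower_subfield.
  - by exists K; split=> //; apply: subfield_div => //; apply: tower_subfield.
move=> x [c0 [c1 [c2 [c3 [[i0 i1 i2 i3] nz e]]]]].
have [K [tK k0 k1]] := dir2 _ _ i0 i1; have [L [tL l2 l3]] := dir2 _ _ i2 i3.
have [M [tM KM LM]] := tower_directed tK tL.
have [|N [tN MN Nx]] := @tower_adjoin M x tM; last by exists N.
by exists c0, c1, c2, c3; split=> //; split; by [exact: KM | exact: LM].
Qed.

Lemma tower_sub_cubic_closed K L : cubic_closed K -> tower L -> L `<=` K.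
Proof.
move=> [hK cK]; elim=> [|{}L L' tL LK hL' dLL']; first exact: rational_subset.
have hL := tower_subfield tL.
by move=> x Lx; apply: cK; apply: cubic_over_sub LK _; case: dLL' => dLL';
  apply: (ext_degree_cubic_over hL hL' dLL').
Qed.

Lemma tower_chain (x : R) : in_tower x <->
  exists (n : nat) (F : nat -> set R),
    [/\ forall i : nat, (i <= n)%N -> subfield (F i),
        F 0%N = @rational R,
        forall i : nat, (1 <= i <= n)%N ->
          F i.-1 `<=` F i /\
          (ext_degree (F i.-1) (F i) 2 \/ ext_degree (F i.-1) (F i) 3)
      & F n x].
Proof.
split=> [[K [tK Kx]]|[n [F [hF F0 dF Fnx]]]]; last first.
  exists (F n); split=> //.
  have : (n <= n)%N by []. 
  elim: {1 3}n => [|m IHm] lemn; first by rewrite F0; exact: tower_rational.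
  have [_ dm] := dF m.+1 lemn.
  exact: tower_extend (IHm (ltnW lemn)) (hF _ lemn) dm.
suff [n [F [hF F0 dF Fn]]] : exists n (F : nat -> set R),
    [/\ forall i : nat, (i <= n)%N -> subfield (F i),
        F 0%N = @rational R,
        forall i : nat, (1 <= i <= n)%N ->
          F i.-1 `<=` F i /\
          (ext_degree (F i.-1) (F i) 2 \/ ext_degree (F i.-1) (F i) 3)
      & F n = K] by exists n, F; split=> //; rewrite Fn.
elim: tK {x Kx} => [|{}K L tK [n [F [hF F0 dF Fn]]] hL dKL].
  exists 0%N, (fun=> @rational R); split=> // i; last by case: i.
  by move=> _; apply: subfield_rational.
exists n.+1, (fun i => if (i <= n)%N then F i else L); split=> //.
- by move=> i _; case: ifP => // /hF.
- move=> [//|i] /= ; rewrite ltnS => lein; rewrite lein.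
  case: ltnP => ltin; first exact: (dF i.+1).
  have -> : i = n by apply/eqP; rewrite eqn_leq lein.
  by rewrite Fn; split=> //; case: dKL => -[].
- by rewrite ltnn.
Qed.

Lemma tower_degree K : tower K ->
  exists r s, ext_degree (@rational R) K (2 ^ r * 3 ^ s)%N.
Proof.
elim=> [|{}K L tK [r [s drs]] hL dKL].
  exists 0%N, 0%N; split=> //; exists (fun=> 1); split.
  - by move=> _; apply: subfield1; apply: subfield_rational.
  - by move=> c _; rewrite big_ord_recr big_ord0 /= add0r mulr1 => c0 i;
    rewrite ord1 -c0; congr c; apply/val_inj.
  - by move=> x Qx; exists (fun=> x);
    rewrite big_ord_recr big_ord0 /= add0r mulr1.
have hK := tower_subfield tK; have hQ := subfield_rational R.
case: dKL => dKL; have := ext_degree_mul hQ hK hL drs dKL.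
  by exists r.+1, s; rewrite expnS -mulnA mulnC.
by exists r, s.+1; rewrite expnSr mulnA.
Qed.

End Towers.

(** Split off the 2-part of d; the rest is prime to 2, so it divides 3 ^ s. *)
Lemma dvdn_two_three d r s : (d %| 2 ^ r * 3 ^ s)%N ->
  exists r' s', d = (2 ^ r' * 3 ^ s')%N.
Proof.
move=> dvd; have d0 : (0 < d)%N by apply: dvdn_gt0 dvd;
  rewrite muln_gt0 !expn_gt0.
have [m cop2m dE] := pfactor_coprime (isT : prime 2) d0.
have : (m %| 2 ^ r * 3 ^ s)%N by apply: dvdn_trans dvd; rewrite dE dvdn_mulr.
rewrite Gauss_dvdr; last by rewrite coprime_sym coprimeXl.
by move=> /(dvdn_pfactor _ _ (isT : prime 3))[k _ mE]; exists (logn 2 d), k;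
  rewrite mulnC -mE.
Qed.

Lemma subfield_rational_adjoin (R : realType) (x : R) :
  subfield (rational_adjoin x).
Proof.
apply: subfieldP => [K hK _|y z Ay Az K hK Kx|y z Ay Az K hK Kx].
- exact: subfield1.
- by apply: subfieldB => //; [apply: Ay | apply: Az].
- by apply: subfield_div => //; [apply: Ay | apply: Az].
Qed.

Lemma in_tower_degree (R : realType) (x : R) : in_tower x ->
  exists r s, ext_degree (@rational R) (rational_adjoin x) (2 ^ r * 3 ^ s)%N.
Proof.
move=> [K [tK Kx]]; have [r [s drs]] := tower_degree tK.
have hK := tower_subfield tK; have hQ := subfield_rational R.
have hA := subfield_rational_adjoin x.
have [||d [dA /dvdn_two_three[r' [s' dE]]]] := ext_degree_between hQ hA hK _ _
  drs.
- exact: rational_subset.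
- by move=> y; apply.
- by exists r', s'; rewrite -dE.
Qed.

(** * Lines and their equations *)

Section Lines.
Variable R : realType.
Implicit Types (P Q X : R * R).

Definition line_eqn (a b c : R) : set (R * R) :=
  [set X | a * X.1 + b * X.2 = c].

Lemma sum_sqr_gt0 (a b : R) : (a, b) <> (0, 0) -> 0 < a ^+ 2 + b ^+ 2.
Proof.
move=> ab; rewrite lt0r addr_ge0 ?sqr_ge0 // andbT.
apply/negP; rewrite paddr_eq0 ?sqr_ge0 // !sqrf_eq0 => /andP[/eqP a0 /eqP b0].
by apply: ab; rewrite a0 b0.
Qed.

Lemma point_neq P Q : P <> Q -> (Q.1 - P.1, Q.2 - P.2) <> (0, 0).
Proof.
case: P Q => p1 p2 [q1 q2] /= PQ [/eqP]; rewrite subr_eq0 => /eqP e1 /eqP.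
by rewrite subr_eq0 => /eqP e2; apply: PQ; rewrite e1 e2.
Qed.

Lemma normal_neq P Q : P <> Q -> (Q.2 - P.2, P.1 - Q.1) <> (0, 0).
Proof.
move=> PQ [e2 /eqP e1]; apply: (point_neq PQ); rewrite e2.
by rewrite -opprB oppr_eq0 in e1; rewrite (eqP e1).
Qed.

Lemma orthogonal_collinear (a b x1 x2 y1 y2 : R) : (a, b) <> (0, 0) ->
  a * x1 + b * x2 = 0 -> a * y1 + b * y2 = 0 -> x1 * y2 = x2 * y1.
Proof.
move=> /sum_sqr_gt0/lt0r_neq0 nz ex ey; apply: (mulfI nz); apply/eqP.
rewrite -subr_eq0; apply/eqP.
transitivity ((a * x1 + b * x2) * (a * y2 - b * y1) -
  (a * y1 + b * y2) * (a * x2 - b * x1)); first by ring.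
by rewrite ex ey !mul0r subr0.
Qed.

Lemma line_throughE a b c P Q : (a, b) <> (0, 0) -> P <> Q ->
  line_eqn a b c P -> line_eqn a b c Q -> line_through P Q = line_eqn a b c.
Proof.
move=> ab /point_neq/sum_sqr_gt0/lt0r_neq0 nz; rewrite /line_eqn /= => eP eQ.
apply/seteqP; split=> [_ [t ->] /=|[x1 x2] /= eX].
  by rewrite -[RHS]eP -[RHS]addr0 -[X in _ = _ + X](mulr0 t) -(subrr c) -{1}eQ
    -eP; ring.
have cr : (x1 - P.1) * (Q.2 - P.2) = (x2 - P.2) * (Q.1 - P.1).
  by apply: (orthogonal_collinear ab); apply/eqP;
    rewrite !mulrBr addrACA -opprD subr_eq0 ?eX ?eQ eP.
exists (((x1 - P.1) * (Q.1 - P.1) + (x2 - P.2) * (Q.2 - P.2)) /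
  ((Q.1 - P.1) ^+ 2 + (Q.2 - P.2) ^+ 2)).
congr pair; apply: (mulfI nz); apply/eqP; rewrite -subr_eq0; apply/eqP.
  transitivity ((Q.2 - P.2) *
    ((x1 - P.1) * (Q.2 - P.2) - (x2 - P.2) * (Q.1 - P.1)));
   [by field | by rewrite cr subrr mulr0].
transitivity ((Q.1 - P.1) * ((x2 - P.2) * (Q.1 - P.1) - (x1 - P.1) * (Q.2 - P.2)));
 [by field | by rewrite cr subrr mulr0].
Qed.

Lemma line_through_eqn P Q : P <> Q ->
  line_through P Q = line_eqn (Q.2 - P.2) (P.1 - Q.1)
    ((Q.2 - P.2) * P.1 + (P.1 - Q.1) * P.2).
Proof.
move=> PQ; apply: line_throughE => //; first exact: normal_neq.
by rewrite /line_eqn /=; ring.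
Qed.

(** The determinant hypothesis says that the lines are parallel, and parallel
lines with a common point coincide. *)
Lemma line_eqn_eq a b c a' b' c' X : (a, b) <> (0, 0) -> (a', b') <> (0, 0) ->
  a * b' = b * a' -> line_eqn a b c X -> line_eqn a' b' c' X ->
  line_eqn a b c = line_eqn a' b' c'.
Proof.
move=> ab ab' det; rewrite /line_eqn /= => eX eX'.
have nz := lt0r_neq0 (sum_sqr_gt0 ab); have nz' := lt0r_neq0 (sum_sqr_gt0 ab').
apply/seteqP; split=> Y /= eY.
  apply: (mulfI nz); apply/eqP; rewrite -subr_eq0 -eX'; apply/eqP.
  transitivity ((a * a' + b * b') * (a * Y.1 + b * Y.2 - (a * X.1 + b * X.2)) +
    (a * b' - b * a') * (a * (Y.2 - X.2) - b * (Y.1 - X.1))); first by ring.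
  by rewrite eY eX det !subrr mulr0 mul0r addr0.
apply: (mulfI nz'); apply/eqP; rewrite -subr_eq0 -eX; apply/eqP.
transitivity ((a * a' + b * b') * (a' * Y.1 + b' * Y.2 - (a' * X.1 + b' * X.2))
  +
  (a * b' - b * a') * (b' * (Y.1 - X.1) - a' * (Y.2 - X.2))); first by ring.
by rewrite eY eX' det !subrr mulr0 mul0r addr0.
Qed.

Lemma line_eqn_det a b c a' b' c' P : (a, b) <> (0, 0) -> (a', b') <> (0, 0) ->
  line_eqn a b c <> line_eqn a' b' c' ->
  line_eqn a b c P -> line_eqn a' b' c' P -> a * b' - b * a' != 0.
Proof.
move=> ab ab' ll' lP lP'; apply/negP; rewrite subr_eq0 => /eqP det.
by apply: ll'; apply: line_eqn_eq lP lP'.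
Qed.

Lemma dist_eq P Q P' Q' : (dist P Q = dist P' Q') <->
  (P.1 - Q.1) ^+ 2 + (P.2 - Q.2) ^+ 2 = (P'.1 - Q'.1) ^+ 2 + (P'.2 - Q'.2) ^+ 2.
Proof.
rewrite /dist; split=> [|-> //] /eqP.
by rewrite eqr_sqrt ?addr_ge0 ?sqr_ge0 // => /eqP.
Qed.

Lemma perp_bisectorE P Q : perp_bisector P Q =
  line_eqn (2 * (Q.1 - P.1)) (2 * (Q.2 - P.2))
    (Q.1 ^+ 2 + Q.2 ^+ 2 - P.1 ^+ 2 - P.2 ^+ 2).
Proof.
apply/seteqP; split=> X; rewrite /perp_bisector /line_eqn /= dist_eq => e.
  by apply/eqP; rewrite -subr_eq0 -(subrr ((X.1 - P.1) ^+ 2 + (X.2 - P.2) ^+ 2))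
    {2}e; apply/eqP; ring.
apply/eqP; rewrite -subr_eq0; apply/eqP.
transitivity (2 * (Q.1 - P.1) * X.1 + 2 * (Q.2 - P.2) * X.2 -
  (Q.1 ^+ 2 + Q.2 ^+ 2 - P.1 ^+ 2 - P.2 ^+ 2)); [by ring | by rewrite e subrr].
Qed.

Lemma mul2_neq (a b : R) : (a, b) <> (0, 0) -> (2 * a, 2 * b) <> (0, 0).
Proof.
move=> ab [/eqP + /eqP]; rewrite !mulf_eq0 !pnatr_eq0 /= => /eqP a0 /eqP b0.
by apply: ab; rewrite a0 b0.
Qed.

(** Both segments are perpendicular to their common perpendicular bisector. *)
Lemma perp_bisector_collinear P P' Q Q' : P <> P' -> Q <> Q' ->
  perp_bisector P P' = perp_bisector Q Q' ->
  (P'.1 - P.1) * (Q'.2 - Q.2) = (P'.2 - P.2) * (Q'.1 - Q.1).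
Proof.
move=> PP QQ; rewrite !perp_bisectorE => /seteqP[_ s].
(* The perpendicular bisector of Q and Q', parametrized from their midpoint. *)
pose M t : R * R := ((Q.1 + Q'.1) / 2 + t * (Q'.2 - Q.2),
   (Q.2 + Q'.2) / 2 - t * (Q'.1 - Q.1)).
have /s e0 : line_eqn (2 * (Q'.1 - Q.1)) (2 * (Q'.2 - Q.2))
    (Q'.1 ^+ 2 + Q'.2 ^+ 2 - Q.1 ^+ 2 - Q.2 ^+ 2) (M 0).
  by rewrite /line_eqn /M /=; field.
have /s e1 : line_eqn (2 * (Q'.1 - Q.1)) (2 * (Q'.2 - Q.2))
    (Q'.1 ^+ 2 + Q'.2 ^+ 2 - Q.1 ^+ 2 - Q.2 ^+ 2) (M (1 / 2)).
  by rewrite /line_eqn /M /=; field.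
move: e0 e1; rewrite /line_eqn /M /= => <- /eqP; rewrite -subr_eq0 => /eqP e.
by apply/eqP; rewrite -subr_eq0 -[X in _ == X]e; apply/eqP; field.
Qed.

(** If the reflection exchanging P and P' also exchanges Q and Q', then Q' - Q is
a multiple of n = P' - P; the factor k / |n|^2 is found from the fact that the
midpoint of Q and Q' lies on the perpendicular bisector of P and P'. *)
Lemma common_perp_bisector P P' Q Q' : P <> P' -> Q <> Q' ->
  perp_bisector P P' = perp_bisector Q Q' ->
  forall n1 n2 k, P'.1 - P.1 = n1 -> P'.2 - P.2 = n2 ->
  k = 2 * (n1 * (P.1 - Q.1) + n2 * (P.2 - Q.2)) + (n1 ^+ 2 + n2 ^+ 2) ->
  (n1 ^+ 2 + n2 ^+ 2) * (Q'.1 - Q.1) = k * n1 /\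
  (n1 ^+ 2 + n2 ^+ 2) * (Q'.2 - Q.2) = k * n2.
Proof.
move=> PP QQ tE n1 n2 k n1E n2E kE.
have cr := perp_bisector_collinear PP QQ tE; rewrite n1E n2E in cr.
have : perp_bisector Q Q' ((Q.1 + Q'.1) / 2, (Q.2 + Q'.2) / 2).
  by apply/dist_eq => /=; field.
rewrite -tE perp_bisectorE /line_eqn /= => /eqP; rewrite -subr_eq0 => /eqP eM.
have ek : n1 * (Q'.1 - Q.1) + n2 * (Q'.2 - Q.2) = k.
  apply/eqP; rewrite -subr_eq0 -[X in _ == X]eM; apply/eqP.
  by rewrite kE -n1E -n2E; field.
split; rewrite -ek.
  transitivity ((n1 * (Q'.1 - Q.1) + n2 * (Q'.2 - Q.2)) * n1 -
    n2 * (n1 * (Q'.2 - Q.2) - n2 * (Q'.1 - Q.1))); first by ring.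
  by rewrite cr subrr mulr0 subr0.
transitivity ((n1 * (Q'.1 - Q.1) + n2 * (Q'.2 - Q.2)) * n2 +
  n1 * (n1 * (Q'.2 - Q.2) - n2 * (Q'.1 - Q.1))); first by ring.
by rewrite cr subrr mulr0 addr0.
Qed.

Lemma reflects_perp_bisector (l t : set (R * R)) P P' : ~ l P -> l P' ->
  reflects t P P' -> P <> P' /\ t = perp_bisector P P'.
Proof. by move=> lP lP' [[_ e]|//]; rewrite e in lP'. Qed.

Lemma cauchy_schwarz (u1 u2 v1 v2 : R) :
  (u1 * v1 + u2 * v2) ^+ 2 <= (u1 ^+ 2 + u2 ^+ 2) * (v1 ^+ 2 + v2 ^+ 2).
Proof.
rewrite -subr_ge0; apply: le_trans (sqr_ge0 (u1 * v2 - u2 * v1)) _.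
by rewrite le_eqVlt; apply/orP; left; apply/eqP; ring.
Qed.

Lemma dist_gt0 (P Q : R * R) : P <> Q -> 0 < dist P Q.
Proof.
move=> PQ; rewrite sqrtr_gt0; apply: sum_sqr_gt0 => -[e1 e2].
by apply: (point_neq (nesym PQ)); rewrite e1 e2.
Qed.

Lemma sqr_dist (P Q : R * R) :
  dist P Q ^+ 2 = (P.1 - Q.1) ^+ 2 + (P.2 - Q.2) ^+ 2.
Proof. by rewrite sqr_sqrtr // addr_ge0 ?sqr_ge0. Qed.

Lemma cosine_itv (A O B : R * R) : A <> O -> B <> O ->
  ((A.1 - O.1) * (B.1 - O.1) + (A.2 - O.2) * (B.2 - O.2)) / (dist A O * dist B
    O)
    \in `[-1, 1].
Proof.
move=> /dist_gt0 AO /dist_gt0 BO; rewrite in_itv /= -ler_norml.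
rewrite -(@ler_pXn2r _ 2) ?nnegrE // expr1n real_normK ?num_real //.
rewrite expr_div_n ler_pdivrMr ?exprn_gt0 ?mulr_gt0 // mul1r exprMn !sqr_dist.
exact: cauchy_schwarz.
Qed.

(** Comparing cosines and dividing by the length of OX: the unit vectors along OA
and OB have the same scalar product with X - O. *)
Lemma angle_eq (A B O X : R * R) : A <> O -> B <> O -> X <> O ->
  angle A O X = angle X O B ->
  ((A.1 - O.1) * (X.1 - O.1) + (A.2 - O.2) * (X.2 - O.2)) / dist A O =
  ((B.1 - O.1) * (X.1 - O.1) + (B.2 - O.2) * (X.2 - O.2)) / dist B O.
Proof.
move=> AO BO XO e.
have : cos (angle A O X) = cos (angle X O B) by rewrite e.
rewrite /angle !acosK ?cosine_itv // => {}e.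
have := dist_gt0 AO; have := dist_gt0 BO; have := dist_gt0 XO.
move=> /lt0r_neq0 dX /lt0r_neq0 dB /lt0r_neq0 dA.
apply: (mulIf (invr_neq0 dX)).
transitivity (((A.1 - O.1) * (X.1 - O.1) + (A.2 - O.2) * (X.2 - O.2)) / (dist A
  O * dist X O)).
  by field; rewrite dA dX.
by rewrite e; field; rewrite dB dX.
Qed.

End Lines.

(** * Constructions stay in cubic closed fields *)

Section CoordinateField.
Variables (R : realType) (K : set R).
Hypothesis cK : cubic_closed K.
Let hK : subfield K := cK.1.

Lemma cubic_closed_sqr x : K (x ^+ 2) -> K x.
Proof.
move=> Kx; apply: cK.2; exists (- x ^+ 2), 0, 1, 0; split.
- by split; in_subfield.
- by case=> _ _ /eqP; rewrite oner_eq0.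
- by ring.
Qed.

Lemma cubic_closed_sqrt x : K x -> K (Num.sqrt x).
Proof.
move=> Kx; have [x0|/ltW/ler0_sqrtr ->] := leP 0 x; last by in_subfield.
by apply: cubic_closed_sqr; rewrite sqr_sqrtr.
Qed.

Definition point_over (P : R * R) : Prop := K P.1 /\ K P.2.

Definition line_over (l : set (R * R)) : Prop := exists a b c,
  [/\ K a, K b, K c, (a, b) <> (0, 0) & l = line_eqn a b c].

Lemma point_over_dist P Q : point_over P -> point_over Q -> K (dist P Q).
Proof. by move=> [? ?] [? ?]; apply: cubic_closed_sqrt; in_subfield. Qed.

Lemma line_over_through P Q : P <> Q -> point_over P -> point_over Q ->
  line_over (line_through P Q).
Proof.
move=> PQ [? ?] [? ?]; exists (Q.2 - P.2), (P.1 - Q.1).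
exists ((Q.2 - P.2) * P.1 + (P.1 - Q.1) * P.2); split; in_subfield.
  exact: normal_neq.
exact: line_through_eqn.
Qed.

Lemma line_over_perp_bisector P Q : P <> Q -> point_over P -> point_over Q ->
  line_over (perp_bisector P Q).
Proof.
move=> PQ [? ?] [? ?]; exists (2 * (Q.1 - P.1)), (2 * (Q.2 - P.2)).
exists (Q.1 ^+ 2 + Q.2 ^+ 2 - P.1 ^+ 2 - P.2 ^+ 2); split; in_subfield.
  exact/mul2_neq/point_neq.
exact: perp_bisectorE.
Qed.

Lemma point_over_intersection l m P : line_over l -> line_over m -> l <> m ->
  l P -> m P -> point_over P.
Proof.
move=> [a [b [c [Ka Kb Kc ab ->]]]] [a' [b' [c' [Ka' Kb' Kc' ab' ->]]]] ne lP
  mP.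
have det := line_eqn_det ab ab' ne lP mP.
move: lP mP; rewrite /line_eqn /= => e e'; split.
  have -> : P.1 = (c * b' - c' * b) / (a * b' - b * a').
    by rewrite -e -e'; field.
  by in_subfield.
have -> : P.2 = (a * c' - a' * c) / (a * b' - b * a').
  by rewrite -e -e'; field.
by in_subfield.
Qed.

(** The vector u is the unit vector along OA.  Although A need not have
coordinates in K, there are only two choices for u, both of the form
(-b, a) / sqrt (a^2 + b^2) up to sign; squaring the factor shows that it is in
K. *)
Lemma unit_direction a b c O A : K a -> K b -> (a, b) <> (0, 0) ->
  line_eqn a b c O -> line_eqn a b c A -> A <> O ->
  exists u1 u2, [/\ K u1, K u2, a * u1 + b * u2 = 0, (u1, u2) <> (0, 0) &
    forall w1 w2, ((A.1 - O.1) * w1 + (A.2 - O.2) * w2) / dist A O = u1 * w1 +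
      u2 * w2].
Proof.
move=> Ka Kb ab lO lA AO.
have nz := sum_sqr_gt0 ab; set N := a ^+ 2 + b ^+ 2 in nz.
have KN : K N by rewrite /N; in_subfield.
have d0 := lt0r_neq0 (dist_gt0 AO).
exists ((A.1 - O.1) / dist A O), ((A.2 - O.2) / dist A O).
have eA : a * (A.1 - O.1) + b * (A.2 - O.2) = 0.
  by rewrite !mulrBr addrACA -opprD lO lA subrr.
pose s := (a * (A.2 - O.2) - b * (A.1 - O.1)) / N.
have s1 : A.1 - O.1 = - s * b.
  apply: (mulfI (lt0r_neq0 nz)); apply/eqP; rewrite -subr_eq0; apply/eqP.
  transitivity (a * (a * (A.1 - O.1) + b * (A.2 - O.2)));
    last by rewrite eA mulr0.
  by rewrite /s /N; field; rewrite lt0r_neq0.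
have s2 : A.2 - O.2 = s * a.
  apply: (mulfI (lt0r_neq0 nz)); apply/eqP; rewrite -subr_eq0; apply/eqP.
  transitivity (b * (a * (A.1 - O.1) + b * (A.2 - O.2)));
    last by rewrite eA mulr0.
  by rewrite /s /N; field; rewrite lt0r_neq0.
have Ksd : K (s / dist A O).
  apply: cubic_closed_sqr; rewrite expr_div_n sqr_dist s1 s2.
  have s0 : s != 0.
    apply/eqP => s0; move: d0; rewrite /dist s1 s2 s0 oppr0 !mul0r.
    by rewrite expr0n addr0 sqrtr0 eqxx.
  suff -> : s ^+ 2 / ((- s * b) ^+ 2 + (s * a) ^+ 2) = N^-1 by in_subfield.
  have -> : (- s * b) ^+ 2 + (s * a) ^+ 2 = s ^+ 2 * N by rewrite /N; ring.
  by rewrite invfM mulVKf // expf_neq0.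
split.
- by rewrite s1 !mulNr mulrAC; in_subfield.
- by rewrite s2 mulrAC; in_subfield.
- by rewrite !mulrA -mulrDl eA mul0r.
- move=> [/eqP + /eqP];
  rewrite !mulf_eq0 invr_eq0 (negPf d0) !orbF => /eqP e1 /eqP e2.
  by apply: (point_neq (nesym AO)); rewrite e1 e2.
- by move=> w1 w2; field.
Qed.

(** With u and v the unit vectors along OA and OB, the bisector is the line through
O orthogonal to u - v. *)
Lemma line_over_angle_bisector l m b : line_over l -> line_over m -> l <> m ->
  angle_bisector l m b -> line_over b.
Proof.
move=> hl hm lm [O [A [B [X [[lO mO lA mB] [[AO BO XO] [ang ->]]]]]]].
have [KO1 KO2] := point_over_intersection hl hm lm lO mO.
move: hl hm => [a [b0 [c [Ka Kb Kc ab le]]]] [a' [b' [c' [Ka' Kb' Kc' ab'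
  me]]]].
rewrite {l}le in lm lO lA; rewrite {m}me in lm mO mB.
have [u1 [u2 [Ku1 Ku2 eu nu ue]]] := unit_direction Ka Kb ab lO lA AO.
have [v1 [v2 [Kv1 Kv2 ev nv ve]]] := unit_direction Ka' Kb' ab' mO mB BO.
have det := line_eqn_det ab ab' lm lO mO.
have := angle_eq AO BO XO ang; rewrite ue ve => e.
have nuv : (u1 - v1, u2 - v2) <> (0, 0).
  move=> [/eqP + /eqP]; rewrite !subr_eq0 => /eqP e1 /eqP e2.
  move: det; rewrite -e1 -e2 in ev.
  rewrite (orthogonal_collinear nu (x1 := a) (x2 := b0) (y1 := a') (y2 := b'))
    ?subrr ?eqxx //.
    by rewrite -[RHS]eu; ring.
  by rewrite -[RHS]ev; ring.
exists (u1 - v1), (u2 - v2), ((u1 - v1) * O.1 + (u2 - v2) * O.2).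
split; in_subfield; first exact: nuv.
apply: line_throughE => //; first exact: nesym.
apply/eqP; rewrite -subr_eq0; apply/eqP.
transitivity (u1 * (X.1 - O.1) + u2 * (X.2 - O.2) - (v1 * (X.1 - O.1) + v2 *
  (X.2 - O.2))).
  by rewrite /=; ring.
by rewrite e subrr.
Qed.

(** Since Q is on the fold, P' is a point of l at distance QP from Q: decomposing
P' - Q along the normal (a, b) and the direction (-b, a) of l, the first
coordinate k is determined by l and the second one s by the square of the
distance. *)
Lemma line_over_fold_tangent l t P Q P' : line_over l -> point_over P ->
  point_over Q -> ~ l P -> t Q -> reflects t P P' -> l P' -> line_over t.
Proof.
move=> [a [b [c [Ka Kb Kc ab ->]]]] hP hQ lP tQ refl lP'.
have [PP tE] := reflects_perp_bisector lP lP' refl.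
rewrite tE in tQ *; apply: line_over_perp_bisector => //.
move: hP hQ => [KP1 KP2] [KQ1 KQ2].
move/dist_eq: tQ => eQ; rewrite /line_eqn /= in lP'.
have nz := sum_sqr_gt0 ab; set N := a ^+ 2 + b ^+ 2 in nz.
have KN : K N by rewrite /N; in_subfield.
have {}nz := lt0r_neq0 nz.
pose k := (c - (a * Q.1 + b * Q.2)) / N.
pose s := (a * (P'.2 - Q.2) - b * (P'.1 - Q.1)) / N.
have e1 : P'.1 = Q.1 + k * a - s * b.
  by rewrite /k /s -lP' /N; field.
have e2 : P'.2 = Q.2 + k * b + s * a.
  by rewrite /k /s -lP' /N; field.
have Kk : K k by rewrite /k; in_subfield.
suff Ks : K s by rewrite /point_over e1 e2; split; in_subfield.
apply: cubic_closed_sqr.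
suff -> : s ^+ 2 = ((Q.1 - P.1) ^+ 2 + (Q.2 - P.2) ^+ 2) / N - k ^+ 2
  by in_subfield.
by rewrite eQ e1 e2 /N; field.
Qed.

(** Here n = P' - P equals tau (a, b) + s (-b, a), where tau <> 0 is determined by
P and l, and s is unknown.  By [common_perp_bisector] the condition that Q' lie
on m is a polynomial equation of degree at most 3 in s.  If all its
coefficients vanish, then m is parallel to l, the foot of P on l lies on m, and
P - Q is orthogonal to both (a, b) and (-b, a): the two pairs coincide. *)
Lemma line_over_fold_common_tangent (l m t : set (R * R)) (P Q P' Q' : R * R) :
  line_over l -> line_over m -> point_over P -> point_over Q ->
  ~ l P -> ~ m Q -> (P, l) <> (Q, m) -> reflects t P P' -> l P' ->
  reflects t Q Q' -> m Q' -> line_over t.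
Proof.
move=> [a [b [c [Ka Kb Kc ab lE]]]] [a' [b' [c' [Ka' Kb' Kc' ab' mE]]]] hP hQ.
move=> lP mQ PlQm reflP lP' reflQ mQ'.
have [PP tE] := reflects_perp_bisector lP lP' reflP.
have [QQ tE'] := reflects_perp_bisector mQ mQ' reflQ.
rewrite tE; apply: line_over_perp_bisector => //.
rewrite lE /line_eqn /= in lP lP'; rewrite mE /line_eqn /= in mQ mQ'.
move: hP hQ => [KP1 KP2] [KQ1 KQ2].
have nz := sum_sqr_gt0 ab; set N := a ^+ 2 + b ^+ 2 in nz.
have KN : K N by rewrite /N; in_subfield.
have {}nz := lt0r_neq0 nz.
pose tau := (c - (a * P.1 + b * P.2)) / N.
pose s := (a * (P'.2 - P.2) - b * (P'.1 - P.1)) / N.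
have e1 : P'.1 - P.1 = tau * a - s * b by rewrite /tau /s -lP' /N; field.
have e2 : P'.2 - P.2 = tau * b + s * a by rewrite /tau /s -lP' /N; field.
have tau0 : tau != 0.
  apply/negP; rewrite mulf_eq0 invr_eq0 (negPf nz) orbF subr_eq0 => /eqP e.
  by apply: lP.
have Kt : K tau by rewrite /tau; in_subfield.
suff Ks : K s.
  rewrite /point_over; split.
    by rewrite -[P'.1](subrK P.1) e1; in_subfield.
  by rewrite -[P'.2](subrK P.2) e2; in_subfield.
have := common_perp_bisector PP QQ (etrans (esym tE) tE') e1 e2 erefl.
pose gam := c' - (a' * Q.1 + b' * Q.2).
have gam0 : gam != 0 by rewrite subr_eq0; apply/eqP => e; apply: mQ.
pose e := a * (P.1 - Q.1) + b * (P.2 - Q.2).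
pose f := a * (P.2 - Q.2) - b * (P.1 - Q.1).
pose g := a' * a + b' * b; pose h := b' * a - a' * b.
have -> : (tau * a - s * b) ^+ 2 + (tau * b + s * a) ^+ 2 =
    N * (tau ^+ 2 + s ^+ 2).
  by rewrite /N; ring.
have -> : (tau * a - s * b) * (P.1 - Q.1) + (tau * b + s * a) * (P.2 - Q.2) =
    tau * e + s * f.
  by rewrite /e /f; ring.
move=> [eQ1 eQ2].
(* The equation of m at Q', multiplied by |n|^2. *)
have ec : N * (tau ^+ 2 + s ^+ 2) * gam =
    (2 * (tau * e + s * f) + N * (tau ^+ 2 + s ^+ 2)) * (tau * g + s * h).
  transitivity (a' * (N * (tau ^+ 2 + s ^+ 2) * (Q'.1 - Q.1)) +
    b' * (N * (tau ^+ 2 + s ^+ 2) * (Q'.2 - Q.2))).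
    by rewrite /gam -mQ'; ring.
  by rewrite eQ1 eQ2 /g /h; ring.
have Kgam : K gam by rewrite /gam; in_subfield.
have Ke : K e by rewrite /e; in_subfield.
have Kf : K f by rewrite /f; in_subfield.
have Kg : K g by rewrite /g; in_subfield.
have Kh : K h by rewrite /h; in_subfield.
apply: cK.2.
exists (N * tau ^+ 2 * gam - (2 * tau * e + N * tau ^+ 2) * (tau * g)).
exists (- (2 * f * (tau * g) + (2 * tau * e + N * tau ^+ 2) * h)).
exists (N * gam - N * tau * g - 2 * f * h), (- (N * h)).
split; first by split; in_subfield.
  move=> [z0 z1 z2 /eqP]; rewrite oppr_eq0 mulf_eq0 (negPf nz) /= => /eqP h0.
  have gE : gam = tau * g.
    by apply: (mulfI nz); apply/eqP; rewrite -subr_eq0 -[X in _ == X]z2 h0;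
      apply/eqP; ring.
  have tg0 : tau * g != 0 by rewrite -gE.
  have f0 : f = 0.
    apply: (mulIf tg0); apply: (mulfI (_ : 2 != 0 :> R));
      first by rewrite pnatr_eq0.
    by rewrite mul0r mulr0; apply: oppr_inj; rewrite oppr0 -[RHS]z1 h0; ring.
  have e0 : e = 0.
    apply: (mulIf tg0); apply: (mulfI tau0); apply: (mulfI (_ : 2 != 0 :> R)).
      by rewrite pnatr_eq0.
    by rewrite mul0r !mulr0; apply: oppr_inj; rewrite oppr0 -[RHS]z0 gE; ring.
  have p1 : P.1 = Q.1.
    apply/eqP; rewrite -subr_eq0; apply/eqP; apply: (mulfI nz).
    rewrite mulr0 -(mulr0 a) -[X in _ = _ * X]e0 -[LHS]addr0 -(mulr0 b) -f0.
    by rewrite /e /f /N; ring.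
  have p2 : P.2 = Q.2.
    apply/eqP; rewrite -subr_eq0; apply/eqP; apply: (mulfI nz).
    rewrite mulr0 -(mulr0 b) -[X in _ = _ * X]e0 -[LHS]subr0 -(mulr0 a) -f0.
    by rewrite /e /f /N; ring.
  apply: PlQm; congr pair; last first.
    rewrite lE mE.
    apply: (@line_eqn_eq _ _ _ _ _ _ _ (P.1 + tau * a, P.2 + tau * b)) => //.
    - by apply/eqP; rewrite -subr_eq0 -[X in _ == X]h0 /h; apply/eqP; ring.
    - by rewrite /line_eqn /tau /N /=; field.
    - rewrite /line_eqn /= p1 p2 -[RHS](subrK (a' * Q.1 + b' * Q.2)) -/gam gE
      /g.
      by ring.
  by case: (P) (Q) p1 p2 => ? ? [? ?] /= -> ->.
by apply/eqP; rewrite -[X in _ == X](subrr (N * (tau ^+ 2 + s ^+ 2) * gam))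
  {2}ec; apply/eqP; ring.
Qed.

End CoordinateField.

Scheme constructed_point_mind := Minimality for constructed_point Sort Prop
  with constructed_line_mind := Minimality for constructed_line Sort Prop.
Combined Scheme constructed_mutind from constructed_point_mind,
  constructed_line_mind.

Lemma constructed_over (R : realType) (K : set R) : cubic_closed K ->
  (forall P, constructed_point P -> point_over K P) /\
  (forall l, constructed_line l -> line_over K l).
Proof.
move=> cK; have hK := cK.1; apply: constructed_mutind.
- by split; in_subfield.
- by split; in_subfield.
- by move=> l m P _ hl _ hm lm _ lP mP;
  apply: (point_over_intersection cK hl hm lm).
- by move=> P Q _ hP _ hQ PQ; apply: line_over_through.
- by move=> P Q _ hP _ hQ PQ; apply: line_over_perp_bisector.
- by move=> l m b _ hl _ hm lm _; apply: (line_over_angle_bisector cK hl hm).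
- move=> l t P Q P' _ hl _ hP _ hQ lP _ tQ refl.
  exact: (line_over_fold_tangent cK hl hP hQ lP tQ refl).
- move=> l m t P Q P' Q' _ hl _ hm _ hP _ hQ lP mQ ne _ rP lP'.
  exact: (line_over_fold_common_tangent cK hl hm hP hQ lP mQ ne rP lP').
Qed.

Lemma origami_sub_cubic_closed (R : realType) (K : set R) :
  cubic_closed K -> origami R `<=` K.
Proof.
move=> cK x; have [hP _] := constructed_over cK; have hK := cK.1.
have lenK y : constructible_length y -> K y.
  by move=> [P [Q [/hP KP /hP KQ ->]]]; apply: point_over_dist.
case=> -[_ /lenK] //.
by rewrite -{2}[x]opprK; apply: subfieldN.
Qed.

Ltac line_arith := rewrite /line_eqn /=; first [lra | by apply/eqP; lra].

(** * Constructible points form a plane over a cubic closed field *)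

Section Constructions.
Variable R : realType.
Implicit Types (A B P Q X : R * R) (l m : set (R * R)).
Local Notation cp := (@constructed_point R).
Local Notation cl := (@constructed_line R).

Lemma constructed_intersection_eqn a b c a' b' c' X :
  cl (line_eqn a b c) -> cl (line_eqn a' b' c') -> a * b' - b * a' != 0 ->
  line_eqn a b c X -> line_eqn a' b' c' X -> cp X.
Proof.
move=> hl hm det lX mX.
have lm : line_eqn a b c <> line_eqn a' b' c'.
  move=> e; have : line_eqn a b c (X.1 - b, X.2 + a).
    by move: (lX); rewrite /line_eqn /= => <-; ring.
  move: (mX); rewrite e /line_eqn /= => <- /eqP; rewrite -subr_eq0.
  by apply/negP; apply: contraNneq det => e'; rewrite -e'; apply/eqP; ring.
apply: (constructed_intersection hl hm lm _ lX mX) => -[//|e].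
by suff : set0 X by []; rewrite -e.
Qed.

Lemma constructed_meet A B P Q X : cp A -> cp B -> cp P -> cp Q ->
  (B.1 - A.1) * (Q.2 - P.2) - (B.2 - A.2) * (Q.1 - P.1) != 0 ->
  (B.2 - A.2) * (X.1 - A.1) = (B.1 - A.1) * (X.2 - A.2) ->
  (Q.2 - P.2) * (X.1 - P.1) = (Q.1 - P.1) * (X.2 - P.2) -> cp X.
Proof.
move=> hA hB hP hQ det eA eP.
have AB : A <> B by move=> AB; move: det; rewrite AB !subrr !mul0r subrr eqxx.
have PQ : P <> Q by move=> PQ; move: det; rewrite PQ !subrr !mulr0 subrr eqxx.
have := constructed_line_through hA hB AB; rewrite (line_through_eqn AB) => lA.
have := constructed_line_through hP hQ PQ; rewrite (line_through_eqn PQ) => lP.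
apply: constructed_intersection_eqn lA lP _ _ _; rewrite /line_eqn /=.
- suff -> : (B.2 - A.2) * (P.1 - Q.1) - (A.1 - B.1) * (Q.2 - P.2) =
    (B.1 - A.1) * (Q.2 - P.2) - (B.2 - A.2) * (Q.1 - P.1) by []; ring.
- apply/eqP; rewrite -subr_eq0; apply/eqP.
  transitivity ((B.2 - A.2) * (X.1 - A.1) - (B.1 - A.1) * (X.2 - A.2)).
    by ring.
  by rewrite eA subrr.
- apply/eqP; rewrite -subr_eq0; apply/eqP.
  transitivity ((Q.2 - P.2) * (X.1 - P.1) - (Q.1 - P.1) * (X.2 - P.2)).
    by ring.
  by rewrite eP subrr.
Qed.

Lemma constructed_midpoint A B : cp A -> cp B -> A <> B ->
  cp ((A.1 + B.1) / 2, (A.2 + B.2) / 2).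
Proof.
move=> hA hB AB.
have := constructed_line_through hA hB AB; rewrite (line_through_eqn AB) => lA.
have := constructed_perp_bisector hA hB AB; rewrite perp_bisectorE => lM.
apply: constructed_intersection_eqn lA lM _ _ _; rewrite /line_eqn /=;
  try by field.
have := lt0r_neq0 (sum_sqr_gt0 (point_neq AB)).
apply: contraNneq => e; apply/eqP; apply: (mulfI (_ : 2 != 0 :> R)).
  by rewrite pnatr_eq0.
by rewrite mulr0 -[RHS]e; ring.
Qed.

(** Steiner's trapezoid: with M the midpoint of AB and S a point of the line AP,
let D be the intersection of PB and SM, and E that of AD and SB.  By the
theorem of Ceva, PE is parallel to AB.  In the affine frame (A, B - A, P - A)
the choice S = (0, 1/4) gives D = (3/2, -1/2) and E = (-3, 1). *)
Lemma constructed_steiner A B P : cp A -> cp B -> cp P ->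
  (B.1 - A.1) * (P.2 - A.2) - (B.2 - A.2) * (P.1 - A.1) != 0 ->
  cp (P.1 - 3 * (B.1 - A.1), P.2 - 3 * (B.2 - A.2)).
Proof.
move=> hA hB hP; set det := (X in X != 0) => det0.
have AB : A <> B by move=> AB; move: det0;
  rewrite /det AB !subrr !mul0r subrr eqxx.
have AP : A <> P by move=> AP; move: det0;
  rewrite /det AP !subrr !mulr0 subrr eqxx.
have hM := constructed_midpoint hA hB AB;
  have hT := constructed_midpoint hA hP AP.
have AT : A <> ((A.1 + P.1) / 2, (A.2 + P.2) / 2).
  move=> e; apply: AP; case: (A) (P) e => [a1 a2] [p1 p2] /= [e1 e2].
  by congr pair; lra.
have hS := constructed_midpoint hA hT AT.
pose D : R * R := (A.1 + 3 / 2 * (B.1 - A.1) - 1 / 2 * (P.1 - A.1),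
          A.2 + 3 / 2 * (B.2 - A.2) - 1 / 2 * (P.2 - A.2)).
have hD : cp D.
  apply: (constructed_meet hP hB hM hS) => /=; [|by rewrite /D /=; field..].
  apply: contraNneq det0 => e; apply/eqP.
  by apply: (mulfI (_ : (4 : R)^-1 != 0));
    rewrite ?invr_eq0 ?pnatr_eq0 // mulr0 -[RHS]oppr0 -[X in _ = - X]e /det;
      field.
apply: (constructed_meet hA hD hS hB) => /=; [|by rewrite /D /=; field..].
apply: contraNneq det0 => e; apply/eqP.
by apply: (mulfI (_ : (8 : R)^-1 != 0));
  rewrite ?invr_eq0 ?pnatr_eq0 // mulr0 -[RHS]e /det /D /=; field.
Qed.

(** If P is on the line AB the parallel is that line; otherwise it passes through
the point given by [constructed_steiner]. *)
Lemma constructed_parallel A B P a b : cp A -> cp B -> cp P -> A <> B ->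
  B.2 - A.2 = a -> A.1 - B.1 = b -> cl (line_eqn a b (a * P.1 + b * P.2)).
Proof.
move=> hA hB hP AB <- <-.
have := normal_neq AB; set n1 := B.2 - A.2; set n2 := A.1 - B.1 => nAB.
have [det|det] :=
  eqVneq ((B.1 - A.1) * (P.2 - A.2) - (B.2 - A.2) * (P.1 - A.1)) 0.
  rewrite -(line_throughE nAB AB); first exact: constructed_line_through.
    by rewrite /line_eqn /=; apply/eqP; rewrite -subr_eq0 -[X in _ == X]det;
      apply/eqP; rewrite /n1 /n2; ring.
  by rewrite /line_eqn /=; apply/eqP; rewrite -subr_eq0 -[X in _ == X]det;
    apply/eqP; rewrite /n1 /n2; ring.
have hE := constructed_steiner hA hB hP det.
set E := (X in cp X) in hE.
have PE : P <> E.
  rewrite /E; move=> e; apply: AB;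
    case: (A) (B) (P) e => [a1 a2] [b1 b2] [p1 p2] /= [e1 e2].
  by congr pair; lra.
rewrite -(line_throughE nAB PE) //; first exact: constructed_line_through.
by rewrite /E /line_eqn /n1 /n2 /=; ring.
Qed.

(** The line onto which P is folded, and the point P' of it, prescribe the fold as
the perpendicular bisector of P and P'; it passes through Q because Q is
equidistant from both. *)
Lemma constructed_fold P P' Q a b c : cl (line_eqn a b c) ->
  cp P -> cp Q -> ~ line_eqn a b c P -> line_eqn a b c P' ->
  dist Q P = dist Q P' -> cl (perp_bisector P P').
Proof.
move=> hl hP hQ lP lP' tQ.
have PP : P <> P' by move=> e; apply: lP; rewrite e.
apply: (constructed_fold_tangent hl hP hQ lP _ _ _ lP') => //; last by right.
rewrite perp_bisectorE; do 3 eexists; split; last by [].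
exact/mul2_neq/point_neq.
Qed.

Let O : R * R := (0, 0).
Let U : R * R := (1, 0).
Let V : R * R := (0, 1).

Lemma constructed_line_through_eqn P Q a b c : cp P -> cp Q ->
  b != 0 -> P.1 != Q.1 -> line_eqn a b c P -> line_eqn a b c Q ->
  cl (line_eqn a b c).
Proof.
move=> hP hQ b0 PQ1 lP lQ.
have PQ : P <> Q by move=> e; rewrite e eqxx in PQ1.
rewrite -(line_throughE _ PQ lP lQ); first exact: constructed_line_through.
by case=> _ /eqP; apply/negP.
Qed.

Lemma constructed_x_axis : cl (line_eqn 0 1 0).
Proof.
by apply: (constructed_line_through_eqn (constructed_origin R)
  (constructed_unit R)); line_arith.
Qed.

Lemma perp_bisector_eqn P Q a b c :
  (forall x y, (2 * (Q.1 - P.1)) * x + (2 * (Q.2 - P.2)) * y =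
    Q.1 ^+ 2 + Q.2 ^+ 2 - P.1 ^+ 2 - P.2 ^+ 2 <-> a * x + b * y = c) ->
  perp_bisector P Q = line_eqn a b c.
Proof. by move=> e; rewrite perp_bisectorE; apply/seteqP; split=> X /e. Qed.

(** Folding U = (1, 0) onto the perpendicular bisector x = 1/2 of the unit segment
gives the two lines of slope 1 and -1 through (1/2, 0).  They provide the points
(1/4, 1/4) and (1/4, -1/4), and folding the former onto the line joining the
latter to the origin gives the axis x = 0. *)
Lemma constructed_unit_ordinate : cp V.
Proof.
have hO : cp O := constructed_origin R; have hU : cp U := constructed_unit R.
have OU : O <> U by case=> /eqP; rewrite eq_sym oner_eq0.
have hM : cp (1 / 2, 0).
  have := constructed_midpoint hO hU OU.
  by rewrite /O /U /= !add0r mul0r.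
have hH : cl (line_eqn 1 0 (1 / 2)).
  rewrite -(@perp_bisector_eqn O U); first exact: constructed_perp_bisector.
  by move=> x y /=; split; lra.
clear OU; have hW : cl (line_eqn 1 0 (1 / 4)).
  rewrite -(@perp_bisector_eqn O (1 / 2, 0)).
    by apply: constructed_perp_bisector => //; case; lra.
  by move=> x y /=; split; lra.
have hD1 : cl (line_eqn 1 1 (1 / 2)).
  rewrite -(@perp_bisector_eqn U (1 / 2, - (1 / 2))).
    apply: (constructed_fold hH hU hM); rewrite /line_eqn /=; try lra.
    by apply/dist_eq => /=; lra.
  by move=> x y /=; split; lra.
have hD2 : cl (line_eqn 1 (-1) (1 / 2)).
  rewrite -(@perp_bisector_eqn U (1 / 2, 1 / 2)).
    apply: (constructed_fold hH hU hM); rewrite /line_eqn /=; try lra.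
    by apply/dist_eq => /=; lra.
  by move=> x y /=; split; lra.
have hP1 : cp (1 / 4, 1 / 4).
  by apply: (constructed_intersection_eqn hW hD1); line_arith.
have hP2 : cp (1 / 4, - (1 / 4)).
  by apply: (constructed_intersection_eqn hW hD2); line_arith.
have hA : cl (line_eqn 1 1 0).
  by apply: (constructed_line_through_eqn hO hP2); line_arith.
have hY : cl (line_eqn 1 0 0).
  rewrite -(@perp_bisector_eqn (1 / 4, 1 / 4) (- (1 / 4), 1 / 4)).
    apply: (constructed_fold hA hP1 hO); rewrite /line_eqn /=; try lra.
    by apply/dist_eq => /=; lra.
  by move=> x y /=; split; lra.
have hC : cp (1 / 2, 1 / 2).
  have hB : cl (line_eqn 1 (-1) 0).
    by apply: (constructed_line_through_eqn hO hP1); line_arith.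
  by apply: (constructed_intersection_eqn hB hH); line_arith.
have hE : cl (line_eqn 1 1 1).
  by apply: (constructed_line_through_eqn hU hC); line_arith.
by apply: (constructed_intersection_eqn hE hY); line_arith.
Qed.

Lemma constructed_vertical P : cp P -> cl (line_eqn 1 0 P.1).
Proof.
move=> hP; have OV : O <> V by case; lra.
have := constructed_parallel (constructed_origin R) constructed_unit_ordinate
  hP OV (erefl _) (erefl _).
by rewrite /= !subr0 mul0r addr0 mul1r.
Qed.

Lemma constructed_horizontal P : cp P -> cl (line_eqn 0 (-1) (- P.2)).
Proof.
move=> hP; have OU : O <> U by case; lra.
have := constructed_parallel (constructed_origin R) (constructed_unit R) hP OU
  (erefl _) (erefl _).
by rewrite /= !sub0r oppr0 mul0r add0r mulN1r.
Qed.

Lemma constructed_antidiagonal P : cp P -> cl (line_eqn 1 1 (P.1 + P.2)).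
Proof.
move=> hP; have UV : U <> V by case; lra.
have := constructed_parallel (constructed_unit R) constructed_unit_ordinate hP
  UV (erefl _) (erefl _).
by rewrite /= !subr0 !mul1r.
Qed.

Definition abscissa (x : R) : Prop := cp (x, 0).

Lemma abscissa_fst P : cp P -> abscissa P.1.
Proof.
move=> /constructed_vertical hP.
by apply: (constructed_intersection_eqn hP constructed_x_axis); line_arith.
Qed.

Lemma abscissa_ordinate y : abscissa y <-> cp (0, y).
Proof.
split=> hy; have hA := constructed_antidiagonal hy.
  have hY := constructed_vertical (constructed_origin R).
  by apply: (constructed_intersection_eqn hA hY); line_arith.
by apply: (constructed_intersection_eqn hA constructed_x_axis); line_arith.
Qed.

Lemma constructed_pointP x y : cp (x, y) <-> abscissa x /\ abscissa y.
Proof.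
split=> [h|[/constructed_vertical hx /abscissa_ordinate/constructed_horizontal
  hy]].
  split; first exact: abscissa_fst h.
  apply/abscissa_ordinate.
  have hY := constructed_vertical (constructed_origin R).
  by apply: (constructed_intersection_eqn (constructed_horizontal h) hY);
    line_arith.
by apply: (constructed_intersection_eqn hx hy); line_arith.
Qed.

(** The parallel through (x, 0) to the line joining (0, 1) and (y, 0). *)
Lemma constructed_slanted x y : abscissa x -> abscissa y -> cl (line_eqn 1 y x).
Proof.
move=> hx hy; have VY : V <> (y, 0) by case; lra.
have := constructed_parallel constructed_unit_ordinate hy hx VY (erefl _)
  (erefl _).
rewrite /= !sub0r mulr0 addr0 mulN1r => h.
suff -> : line_eqn 1 y x = line_eqn (-1) (- y) (- x) by [].
by apply/seteqP; split=> X; rewrite /line_eqn /= mulNr; lra.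
Qed.

(** The line X + y Y = x meets Y = 1 at abscissa x - y and X = 0 at ordinate
x / y. *)
Lemma subfield_abscissa : subfield abscissa.
Proof.
apply: subfieldP => [|x y hx hy|x y hx hy]; first exact: constructed_unit.
  apply: (@abscissa_fst (x - y, 1)).
  have hV := constructed_horizontal constructed_unit_ordinate.
  by apply: (constructed_intersection_eqn (constructed_slanted hx hy) hV);
    line_arith.
have [->|y0] := eqVneq y 0; first by rewrite invr0 mulr0;
  exact: constructed_origin.
apply/abscissa_ordinate.
have hY := constructed_vertical (constructed_origin R).
apply: (constructed_intersection_eqn (constructed_slanted hx hy) hY);
  rewrite /line_eqn /=.
- by rewrite mulr0 sub0r mulr1 oppr_eq0.
- by field.
- by lra.
Qed.

Lemma constructed_line_eqn a b c : abscissa a -> abscissa b -> abscissa c ->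
  (a, b) <> (0, 0) -> cl (line_eqn a b c).
Proof.
move=> ha hb hc ab; have hF := subfield_abscissa.
have [b0|b0] := eqVneq b 0.
  have a0 : a != 0 by apply/eqP => a0; apply: ab; rewrite a0 b0.
  have hP : cp (c / a, 0) by apply/constructed_pointP; split; in_subfield.
  suff -> : line_eqn a b c = line_eqn 1 0 (c / a)
    by apply: (constructed_vertical hP).
  apply/seteqP; split=> X; rewrite /line_eqn /= b0 !mul0r !addr0 mul1r.
    by move=> <-; rewrite mulrC mulKf.
  by move=> ->; rewrite mulrC divfK.
have hP : cp (0, c / b) by apply/constructed_pointP; split; in_subfield.
have hQ : cp (1, (c - a) / b) by apply/constructed_pointP; split; in_subfield.
have PQ : (0, c / b) <> (1, (c - a) / b) :> R * R by move=> [/eqP + _];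
  rewrite eq_sym oner_eq0.
rewrite -(line_throughE ab PQ); first exact: constructed_line_through.
  by rewrite /line_eqn /=; field.
by rewrite /line_eqn /=; field.
Qed.

(** Beloch's fold.  Folding V = (0, 1) onto (2 s, -1) is done along y = s x - s^2.
This fold sends Q = (c - a, b) to a point of the vertical line x = - a - c
exactly when s is a root of the cubic, and Q is not on that line since c <> 0.
Once the fold is drawn, s is read off from its intersections with x = 0 and
x = 1. *)
Lemma abscissa_monic_cubic_root a b c s :
  abscissa a -> abscissa b -> abscissa c -> c != 0 ->
  s ^+ 3 + a * s ^+ 2 + b * s + c = 0 -> abscissa s.
Proof.
move=> ha hb hc c0 es; have hF := subfield_abscissa.
(* Q' = Q - k (s, -1) is the reflection of Q in the fold. *)
pose Q : R * R := (c - a, b);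
  pose k := 2 * (s * Q.1 - Q.2 - s ^+ 2) / (s ^+ 2 + 1).
pose P' : R * R := (2 * s, -1); pose Q' : R * R := (Q.1 - k * s, Q.2 + k).
have s1 : s ^+ 2 + 1 != 0 by rewrite lt0r_neq0 // ltr_wpDl ?sqr_ge0.
have hQ : cp Q by apply/constructed_pointP; split; rewrite /Q /=; in_subfield.
have hl : cl (line_eqn 0 1 (-1)).
  by apply: constructed_line_eqn; in_subfield; case; lra.
have hm : cl (line_eqn 1 0 (- a - c)).
  by apply: constructed_line_eqn; in_subfield; case; lra.
have lV : ~ line_eqn 0 1 (-1) V by rewrite /line_eqn /=; lra.
have mQ : ~ line_eqn 1 0 (- a - c) Q.
  rewrite /line_eqn /= => e; move: c0; rewrite (_ : c = 0) ?eqxx //.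
  by lra.
have lP' : line_eqn 0 1 (-1) P' by rewrite /line_eqn /=; lra.
have mQ' : line_eqn 1 0 (- a - c) Q'.
  rewrite /line_eqn /= mul1r mul0r addr0; apply: (mulfI s1); apply/eqP.
  rewrite -subr_eq0 -(mulr0 2) -[X in _ == _ * X]es /k /=; apply/eqP; field.
  by rewrite s1.
have VP : V <> P' by case; lra.
have QQ : Q <> Q' by move=> e; apply: mQ; rewrite e.
have t0 : line_eqn s (-1) (s ^+ 2) (0, - s ^+ 2) by rewrite /line_eqn /=; ring.
have sN : (s, -1) <> (0, 0) :> R * R by case; lra.
have tP : perp_bisector V P' = line_eqn s (-1) (s ^+ 2).
  by apply: perp_bisector_eqn => x y /=; split; nra.
have tQ : perp_bisector Q Q' = line_eqn s (-1) (s ^+ 2).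
  rewrite perp_bisectorE;
    apply: (@line_eqn_eq _ _ _ _ _ _ _ (0, - s ^+ 2)) => //.
  - exact/mul2_neq/point_neq.
  - by rewrite /=; ring.
  - by rewrite /line_eqn /Q' /k /Q /=; field; rewrite s1.
have ht : cl (line_eqn s (-1) (s ^+ 2)).
  apply: (constructed_fold_common_tangent hl hm constructed_unit_ordinate hQ lV
    mQ _ _ _ lP' _ mQ').
  - case=> _ _ e; have : line_eqn 0 1 (-1) (- a - c, 0).
      by rewrite e /line_eqn /=; ring.
    by rewrite /line_eqn /=; lra.
  - by exists s, (-1), (s ^+ 2).
  - by right; rewrite tP.
  - by right; rewrite tQ.
have hY := constructed_vertical (constructed_origin R).
have hU := constructed_vertical (constructed_unit R).
have /constructed_pointP[_ h0] : cp (0, - s ^+ 2).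
  by apply: (constructed_intersection_eqn ht hY); line_arith.
have /constructed_pointP[_ h1] : cp (1, s - s ^+ 2).
  by apply: (constructed_intersection_eqn ht hU); line_arith.
have -> : s = s - s ^+ 2 - (- s ^+ 2) by ring.
exact: subfieldB.
Qed.

(** A nonzero root of a cubic is a root of a polynomial with nonzero constant term;
if the latter is quadratic, it is multiplied by x - 1 to apply the fold. *)
Lemma abscissa_cubic_closed : cubic_closed abscissa.
Proof.
have hF := subfield_abscissa; split=> // x.
have [->|x0] := eqVneq x 0; first by move=> _; exact: subfield0.
move=> /cubic_over_const/(_ x0)[c0 [c1 [c2 [c3 [[k0 k1 k2 k3] nz e]]]]].
have [z3|z3] := eqVneq c3 0; last first.
  apply: (@abscissa_monic_cubic_root (c2 / c3) (c1 / c3) (c0 / c3));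
    in_subfield.
    by rewrite mulf_neq0 ?invr_eq0.
  by apply: (mulfI z3); rewrite mulr0 -[RHS]e; field.
have [z2|z2] := eqVneq c2 0; last first.
  apply: (@abscissa_monic_cubic_root (c1 / c2 - 1) (c0 / c2 - c1 / c2) (- (c0 /
    c2))); in_subfield.
    by rewrite oppr_eq0 mulf_neq0 ?invr_eq0.
  by apply: (mulfI z2); rewrite mulr0 -(mulr0 (x - 1)) -[X in _ = _ * X]e z3;
    field.
have z1 : c1 != 0.
  by apply: contraNneq nz => z1; rewrite -[X in _ == X]e z1 z2 z3; apply/eqP;
    ring.
have -> : x = - (c0 / c1).
  apply: (mulfI z1); apply/eqP; rewrite -subr_eq0 -[X in _ == X]e z2 z3.
  by apply/eqP; field.
by in_subfield.
Qed.

Lemma abscissa_sub_origami : abscissa `<=` origami R.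
Proof.
have hF := subfield_abscissa.
have len x : abscissa x -> 0 <= x -> constructible_length x.
  move=> hx x0; exists (x, 0), O; split=> //; first exact: constructed_origin.
  by rewrite /dist /= !subr0 expr0n addr0 sqrtr_sqr ger0_norm.
move=> x hx; have [x0|x0] := leP 0 x; [left|right]; split=> //;
  first exact: len.
by apply: len; [in_subfield | rewrite oppr_ge0 ltW].
Qed.

End Constructions.

(** * The characterization of origami numbers *)

Theorem mainTheorem1 (R : realType) (a : R) :
  (origami R a <->
     exists (n : nat) (F : nat -> set R),
       [/\ forall i : nat, (i <= n)%N -> subfield (F i),
           F 0%N = @rational R,
           forall i : nat, (1 <= i <= n)%N ->
             F i.-1 `<=` F i /\
             (ext_degree (F i.-1) (F i) 2 \/ ext_degree (F i.-1) (F i) 3)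
         & F n a]) /\
  (origami R a ->
     exists r s : nat,
       ext_degree (@rational R) (rational_adjoin a) (2 ^ r * 3 ^ s)%N).
Proof.
have origami_tower : origami R `<=` @in_tower R.
  exact: origami_sub_cubic_closed (in_tower_cubic_closed R).
split; last by move=> /origami_tower/in_tower_degree.
rewrite -tower_chain; split=> [/origami_tower //|[K [tK Ka]]].
apply: abscissa_sub_origami.
exact: tower_sub_cubic_closed (abscissa_cubic_closed R) tK _ Ka.
Qed.
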